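(* Let $R$ be any ring and let $\{U_i\mid i\in I\}$ and $\{V_j\mid j\in J\}$ be two families of biuniform right $R$-modules. Assume there exist bijections $\sigma,\tau\colon I\to J$ such that $[U_i]_m=[V_{\sigma(i)}]_m$ and $[U_i]_e=[V_{\tau(i)}]_e$ for every $i\in I$. Then $\prod_{i\in I}U_i\cong\prod_{j\in J}V_j$.
   Context: A module is biuniform if it is both uniform (Goldie dimension 1) and couniform/hollow (dual Goldie dimension 1); in particular it is nonzero. Two modules $M,N$ have $[M]_m=[N]_m$ (same monogeny class) if there exist monomorphisms $M\to N$ and $N\to M$; they have $[M]_e=[N]_e$ (same epigeny class) if there exist epimorphisms $M\to N$ and $N\to M$. (In particular this applies to families of nonzero uniserial modules.) *)

(* Defs.v *)
(* Modules over a ring R are lmodType's.  Right R-modules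
   are modelled as left modules over the converse ring R^c. *)
From HB Require Import structures.
From mathcomp Require Import all_boot all_order all_algebra.
Set Implicit Arguments. Unset Strict Implicit. Unset Printing Implicit Defensive.
Import GRing.Theory.
Local Open Scope ring_scope.

Section ModDefs.
Variable R : pzRingType.

Definition is_submod (M : lmodType R) (P : M -> Prop) : Prop :=
  [/\ P 0, (forall x y, P x -> P y -> P (x + y))
         & (forall (a : R) x, P x -> P (a *: x))].

Definition nonzero_mod (M : lmodType R) : Prop := exists x : M, x != 0.

Definition uniform (M : lmodType R) : Prop :=
  nonzero_mod M /\
  forall P Q : M -> Prop, is_submod P -> is_submod Q ->
    (exists x, P x /\ x != 0) -> (exists x, Q x /\ x != 0) ->
    exists x, [/\ P x, Q x & x != 0].

Definition couniform (M : lmodType R) : Prop :=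
  nonzero_mod M /\
  forall P Q : M -> Prop, is_submod P -> is_submod Q ->
    (forall x : M, exists y z, [/\ P y, Q z & x = y + z]) ->
    (forall x, P x) \/ (forall x, Q x).

Definition biuniform (M : lmodType R) : Prop := uniform M /\ couniform M.

Definition mono_to (M N : lmodType R) : Prop :=
  exists f : {linear M -> N}, injective f.
Definition epi_to (M N : lmodType R) : Prop :=
  exists f : {linear M -> N}, forall y, exists x, f x = y.

Definition same_monogeny (M N : lmodType R) : Prop := mono_to M N /\ mono_to N M.
Definition same_epigeny (M N : lmodType R) : Prop := epi_to M N /\ epi_to N M.

Definition prod_iso (I J : Type) (U : I -> lmodType R) (V : J -> lmodType R) : Prop :=
  exists f : (forall i, U i) -> (forall j, V j),
    [/\ (forall x y, f (fun i => x i + y i) = (fun j => f x j + f y j)),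
        (forall (a : R) x, f (fun i => a *: x i) = (fun j => a *: f x j))
      & bijective f].
End ModDefs.

(* Main.v *)
(* Write W_i for V_(sigma i) and rho for sigma^-1 tau, so that U_i has the monogeny
   class of W_i and the epigeny class of W_(rho i).  A biuniform module is determined
   by its two classes, and exchanging the epigeny classes of two biuniform modules
   does not change their direct sum.  If three of the four modules involved in an
   exchange exist, so does the fourth; hence for a, b in one orbit of rho there is a
   module T(a, b) with the monogeny class of W_a and the epigeny class of W_b.
   An infinite orbit cannot be treated by exchanges along rho itself, but rho is a
   product of two involutions s and s rho, with s reflecting each orbit.  Pairwise
   exchanges along s rho turn prod_i U_i = prod_i T(i, rho i) into prod_i T(i, s i),
   and exchanges along s turn the latter into prod_i T(i, i) = prod_i W_i. *)
Require Import Defs.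
From HB Require Import structures.
From mathcomp Require Import all_boot all_order all_algebra.
From Stdlib Require Import Classical ClassicalEpsilon FunctionalExtensionality PropExtensionality Eqdep.

Set Implicit Arguments.
Unset Strict Implicit.
Unset Printing Implicit Defensive.
Import GRing.Theory.
Local Open Scope ring_scope.

(** * Kernels of linear maps as modules *)

Section Kernel.
Variables (R : pzRingType) (M N : lmodType R) (f : {linear M -> N}).

Definition ker_pred : {pred M} := fun x => f x == 0.

Lemma ker_pred_submod_closed : submod_closed ker_pred.
Proof.
split=> [|a x y]; rewrite !unfold_in ?linear0 //.
by move=> /eqP fx0 /eqP fy0; rewrite linearP fx0 fy0 scaler0 addr0.
Qed.

HB.instance Definition _ := GRing.isSubmodClosed.Build R M ker_pred
  ker_pred_submod_closed.

(** The complement built in the exchange must be a module itself, hence a subtype with the inherited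
    structure rather than a predicate. *)
Record ker_mod := KerMod { ker_val :> M; ker_valP : ker_val \in ker_pred }.

HB.instance Definition _ := [isSub for ker_val].
HB.instance Definition _ := [Choice of ker_mod by <:].
HB.instance Definition _ := [SubChoice_isSubLmodule of ker_mod by <:].

Lemma ker_valE (x : ker_mod) : f (ker_val x) = 0.
Proof. exact/eqP/(ker_valP x). Qed.

End Kernel.

(** * Linear maps, their kernels and images *)

Section Linear.
Variables (R : pzRingType).
Implicit Types (M N P : lmodType R).

Lemma linear_of M N (f : M -> N) : linear f -> exists g : {linear M -> N}, g =1 f.
Proof.
move=> lf; pose g : {linear M -> N} := HB.pack f (GRing.isLinear.Build R M N *:%R f lf).
by exists g.
Qed.

Definition surjective (S T : Type) (f : S -> T) := forall y, exists x, f x = y.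

Lemma inj_surj_bij (S T : Type) (f : S -> T) :
  injective f -> surjective f -> bijective f.
Proof.
move=> finj fsurj.
pose g y := proj1_sig (constructive_indefinite_description _ (fsurj y)).
have fK y : f (g y) = y by rewrite /g; case: constructive_indefinite_description.
by exists g => // x; apply: finj; rewrite fK.
Qed.

Lemma bij_surj (S T : Type) (f : S -> T) : bijective f -> surjective f.
Proof. by case=> g _ gK y; exists (g y). Qed.

Lemma is_submod_ker M N (f : {linear M -> N}) : is_submod (fun x => f x = 0).
Proof.
split=> [|x y fx fy|a x fx]; first exact: linear0.
  by rewrite linearD fx fy addr0.
by rewrite linearZ fx /= scaler0.
Qed.

Lemma is_submod_im M N (f : {linear M -> N}) : is_submod (fun y => exists x, f x = y).
Proof.
split=> [|_ _ [x <-] [y <-]|a _ [x <-]]; first by exists 0; rewrite linear0.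
  by exists (x + y); rewrite linearD.
by exists (a *: x); rewrite linearZ.
Qed.

Lemma not_inj_ker M N (f : {linear M -> N}) :
  ~ injective f -> exists x, f x = 0 /\ x != 0.
Proof.
move=> ninj; apply: NNPP => nex; apply: ninj; apply: raddf_inj => x fx0.
by apply: NNPP => /eqP x0; apply: nex; exists x.
Qed.

Definition lin_iso M N := exists f : {linear M -> N}, bijective f.

End Linear.

(** * Biuniform modules and the exchange of their classes *)

Section Biuniform.
Variables (R : pzRingType).
Implicit Types (A B C D M N P : lmodType R).

Lemma linear_inj M N (f : {linear M -> N}) :
  (forall x, f x = 0 -> x = 0) -> injective f.
Proof. exact: raddf_inj. Qed.

Lemma lin_iso_refl M : lin_iso M M.
Proof.
have [f fE] : exists f : {linear M -> M}, f =1 id by apply: linear_of.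
by exists f; exists id => x; rewrite fE.
Qed.

Lemma lin_inverse M N (f : {linear M -> N}) :
  bijective f -> exists g : {linear N -> M}, cancel f g /\ cancel g f.
Proof.
case=> g fK gK.
have [h hE] : exists h : {linear N -> M}, h =1 g.
  by apply: linear_of => a x y; apply: (can_inj fK); rewrite linearP !gK.
by exists h; split=> x; rewrite hE.
Qed.

Lemma lin_iso_sym M N : lin_iso M N -> lin_iso N M.
Proof. by case=> f /lin_inverse [g [fK gK]]; exists g; exists f. Qed.

Lemma lin_iso_trans M N P : lin_iso M N -> lin_iso N P -> lin_iso M P.
Proof. by case=> f bf [g bg]; exists (g \o f); apply: bij_comp. Qed.

Lemma lin_iso_prod M N P Q : lin_iso M N -> lin_iso P Q ->
  lin_iso (M * P)%type (N * Q)%type.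
Proof.
case=> f [f' fK f'K] [g [g' gK g'K]].
have [h hE] : exists h : {linear (M * P)%type -> (N * Q)%type}, h =1 (fun w => (f w.1, g w.2)).
  by apply: linear_of => a x y /=; rewrite !linearP.
exists h; exists (fun w => (f' w.1, g' w.2)) => -[x y].
  by rewrite hE /= fK gK.
by rewrite hE /= f'K g'K.
Qed.

Lemma lin_iso_swap M N : lin_iso (M * N)%type (N * M)%type.
Proof.
have [h hE] : exists h : {linear (M * N)%type -> (N * M)%type}, h =1 (fun w => (w.2, w.1)).
  by apply: linear_of.
by exists h; exists (fun w => (w.2, w.1)) => -[x y]; rewrite hE.
Qed.

Lemma lin_iso_same_monogeny M N : lin_iso M N -> same_monogeny M N.
Proof.
move=> MN; have [g bg] := lin_iso_sym MN; case: MN => f bf.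
by split; [exists f | exists g]; apply: bij_inj.
Qed.

Lemma lin_iso_same_epigeny M N : lin_iso M N -> same_epigeny M N.
Proof.
move=> MN; have [g bg] := lin_iso_sym MN; case: MN => f bf.
by split; [exists f | exists g]; apply: bij_surj.
Qed.

Lemma same_monogeny_sym M N : same_monogeny M N -> same_monogeny N M.
Proof. by case. Qed.

Lemma same_epigeny_sym M N : same_epigeny M N -> same_epigeny N M.
Proof. by case. Qed.

Lemma same_monogeny_trans M N P :
  same_monogeny M N -> same_monogeny N P -> same_monogeny M P.
Proof.
case=> [[f fi] [f' fi']] [[g gi] [g' gi']].
by split; [exists (g \o f) | exists (f' \o g')]; apply: inj_comp.
Qed.

Lemma same_epigeny_trans M N P :
  same_epigeny M N -> same_epigeny N P -> same_epigeny M P.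
Proof.
have epi_comp (A B C : lmodType R) : epi_to A B -> epi_to B C -> epi_to A C.
  move=> [f fs] [g gs]; exists (g \o f) => z.
  by have [y <-] := gs z; have [x <-] := fs y; exists x.
by case=> ? ? [? ?]; split; apply: epi_comp; eassumption.
Qed.

Lemma same_monogeny_refl M : same_monogeny M M.
Proof. exact/lin_iso_same_monogeny/lin_iso_refl. Qed.

Lemma same_epigeny_refl M : same_epigeny M M.
Proof. exact/lin_iso_same_epigeny/lin_iso_refl. Qed.

(** Two nonzero kernels would share a nonzero element, which [h] kills. *)
Lemma uniform_add_inj M N (f g h : {linear M -> N}) :
  uniform M -> h =1 f \+ g -> injective h -> injective f \/ injective g.
Proof.
move=> [_ uM] hE hi; apply: NNPP => /not_or_and [/not_inj_ker kf /not_inj_ker kg].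
have [x [fx gx /eqP]] := uM _ _ (is_submod_ker f) (is_submod_ker g) kf kg.
by apply; apply: hi; rewrite linear0 hE /= fx gx addr0.
Qed.

(** The images of [f] and [g] add up to [N], so one of them is all of [N]. *)
Lemma couniform_add_surj M N (f g h : {linear M -> N}) :
  couniform N -> h =1 f \+ g -> surjective h -> surjective f \/ surjective g.
Proof.
move=> [_ uN] hE hs; apply: uN (is_submod_im f) (is_submod_im g) _ => y.
have [x <-] := hs y; exists (f x), (g x); split; first by exists x.
  by exists x.
by rewrite hE.
Qed.

(** The two preceding lemmas apply to [f = (f + g) - g] and [g = (f + g) - f]: since [g] is not
    injective, [f + g] is; since [f] is not onto, [f + g] is. *)
Lemma mono_epi_add_bij M N (f g : {linear M -> N}) : uniform M -> couniform N ->
    injective f -> ~ surjective f -> surjective g -> ~ injective g ->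
  bijective (f \+ g).
Proof.
move=> uM uN fi fs gs gi; apply: inj_surj_bij.
  have [|//|gi'] := @uniform_add_inj _ _ (f \+ g) (\- g) f uM _ fi.
    by move=> x /=; rewrite addrK.
  by case: gi => x y gxy; apply: gi'; rewrite /= gxy.
have [|//|fs'] := @couniform_add_surj _ _ (f \+ g) (\- f) g uN _ gs.
  by move=> x /=; rewrite addrC addKr.
by case: fs => y; have [x <-] := fs' y; exists (- x); rewrite linearN.
Qed.

(** If neither the monomorphism nor the epimorphism from [M] to [N] is bijective, their sum is. *)
Lemma biuniform_lin_iso M N : biuniform M -> biuniform N ->
  same_monogeny M N -> same_epigeny M N -> lin_iso M N.
Proof.
move=> [uM _] [_ uN] [[f fi] _] [[g gs] _].
have [fs|fs] := classic (surjective f); first by exists f; apply: inj_surj_bij.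
have [gi|gi] := classic (injective g); first by exists g; apply: inj_surj_bij.
by exists (f \+ g); apply: mono_epi_add_bij.
Qed.

Lemma epi_to_nonzero M N : epi_to M N -> nonzero_mod N -> nonzero_mod M.
Proof.
move=> [f fs] [y]; have [x <-] := fs y => fx0; exists x.
by apply: contra_neq fx0 => ->; rewrite linear0.
Qed.

Lemma mono_to_uniform M N : nonzero_mod M -> mono_to M N -> uniform N -> uniform M.
Proof.
move=> nM [f fi] [_ uN]; split=> // P Q sP sQ [p [Pp p0]] [q [Qq q0]].
have im_submod S : is_submod S -> is_submod (fun y => exists x, S x /\ y = f x).
  move=> [S0 SD SZ]; split=> [|_ _ [x [Sx ->]] [y [Sy ->]]|a _ [x [Sx ->]]].
  - by exists 0; rewrite linear0.
  - by exists (x + y); rewrite linearD; split=> //; apply: SD.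
  - by exists (a *: x); rewrite linearZ; split=> //; apply: SZ.
have f_neq0 x : x != 0 -> f x != 0.
  by apply: contra_neq => fx0; apply: fi; rewrite linear0.
have [||_ [[x [Px ->]] [x' [Qx' /fi xx']] fx0]] :=
    uN _ _ (im_submod P sP) (im_submod Q sQ).
- by exists (f p); split; [exists p | apply: f_neq0].
- by exists (f q); split; [exists q | apply: f_neq0].
exists x; split=> //; first by rewrite xx'.
by apply: contra_neq fx0 => ->; rewrite linear0.
Qed.

(** Submodules with sum [N] have preimages with sum [M]: if [y'] lifts [y], then [x - y'] lifts
    [z]. *)
Lemma epi_to_couniform M N : nonzero_mod N -> epi_to M N -> couniform M -> couniform N.
Proof.
move=> nN [f fs] [_ uM]; split=> // P Q sP sQ PQ.
have preim_submod S : is_submod S -> is_submod (S \o f).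
  move=> [S0 SD SZ]; split=> [|x y Sx Sy|a x Sx] /=.
  - by rewrite linear0.
  - by rewrite linearD; apply: SD.
  - by rewrite linearZ; apply: SZ.
have [|allP|allQ] := uM _ _ (preim_submod P sP) (preim_submod Q sQ).
- move=> x; have [y [z [Py Qz fxE]]] := PQ (f x).
  have [y' fy'] := fs y; exists y', (x - y').
  by rewrite /= linearB fy' fxE addrC addKr addrC subrK.
- by left=> y; have [x <-] := fs y; apply: allP.
- by right=> y; have [x <-] := fs y; apply: allQ.
Qed.

(* If neither factor is isomorphic to A, then A splits off B * C, embedded by
   [(alpha, gamma)], and D is the complement [ker (beta, delta)]. *)
Lemma exchange_exists A B C : biuniform A -> biuniform B -> biuniform C ->
    same_monogeny A B -> same_epigeny A C ->
  exists D, [/\ biuniform D, same_monogeny D C, same_epigeny D B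
              & lin_iso (A * D)%type (B * C)%type].
Proof.
move=> uA uB uC mAB eAC.
(* Degenerate cases: [D = C] if [B] is isomorphic to [A], and [D = B] if [A] is isomorphic to
   [C]. *)
have [isoBA|nisoBA] := classic (lin_iso B A).
  have isoAB := lin_iso_sym isoBA.
  exists C; split=> //; first exact: same_monogeny_refl.
    apply: same_epigeny_trans (same_epigeny_sym eAC) _.
    exact: lin_iso_same_epigeny.
  exact: lin_iso_prod isoAB (lin_iso_refl C).
have [isoAC|nisoAC] := classic (lin_iso A C).
  exists B; split=> //; last 1 first.
  - exact: lin_iso_trans (lin_iso_prod isoAC (lin_iso_refl B)) (lin_iso_swap _ _).
  - apply: same_monogeny_trans (same_monogeny_sym mAB) _.
    exact: lin_iso_same_monogeny.
  - exact: same_epigeny_refl.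
case: (mAB) (eAC) => [[alpha alphai] [beta betai]] [[gamma gammas] [delta deltas]].
have betas : ~ surjective beta.
  by move=> betas; apply: nisoBA; exists beta; apply: inj_surj_bij.
have gammai : ~ injective gamma.
  by move=> gammai; apply: nisoAC; exists gamma; apply: inj_surj_bij.
(* [theta = beta alpha + delta gamma] is an automorphism of [A]: the first summand is injective but
   not onto, as [beta] is not; the second is onto but not injective, as [gamma] is not. *)
have [theta' [thetaK theta'K]] :
    exists theta' : {linear A -> A},
      cancel ((beta \o alpha) \+ (delta \o gamma)) theta' /\
      cancel theta' ((beta \o alpha) \+ (delta \o gamma)).
  apply: lin_inverse; case: uA => uuA ucA; apply: mono_epi_add_bij => //=.
  - exact: inj_comp.
  - by move=> s; apply: betas => y; have [x <-] := s y; exists (alpha x).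
  - move=> y; have [c <-] := deltas y; have [a <-] := gammas c.
    by exists a.
  - by move=> /inj_compr.
have [kappa kappaE] : exists kappa : {linear (B * C)%type -> A},
    kappa =1 fun w => beta w.1 + delta w.2.
  by apply: linear_of => a x y /=; rewrite !linearP scalerDr addrACA.
have kappa_theta a : kappa (alpha a, gamma a) = ((beta \o alpha) \+ (delta \o gamma)) a.
  by rewrite kappaE.
(* The projection onto [ker kappa] along the image of [(alpha, gamma)]. *)
have [pi piE] : exists pi : {linear (B * C)%type -> ker_mod kappa},
    forall w, ker_val (pi w) =
      w - (alpha (theta' (kappa w)), gamma (theta' (kappa w))).
  pose p w := w - (alpha (theta' (kappa w)), gamma (theta' (kappa w))).
  have pP w : p w \in ker_pred kappa.
    by rewrite unfold_in linearB kappa_theta theta'K subrr.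
  have [pi piE] : exists pi : {linear (B * C)%type -> ker_mod kappa},
      pi =1 fun w => KerMod (pP w).
    apply: linear_of => a x y; apply: val_inj.
    rewrite /= /p !linearP /=.
    rewrite scalerDr scalerN addrACA -opprD; congr (_ - _).
  by exists pi => w; rewrite piE.
have valE : @ker_val _ _ _ kappa =1 val by [].
(* The second coordinate is injective on [ker kappa] because [beta] is injective; [c -> pi (0, c)]
   is injective because [alpha] is. *)
have mDC : same_monogeny (ker_mod kappa) C.
  split.
    have [f fE] : exists f : {linear ker_mod kappa -> C}, f =1 fun d => (ker_val d).2.
      by apply: linear_of.
    exists f; apply: linear_inj => d; rewrite fE => d2.
    apply: val_inj; have := ker_valE d; rewrite kappaE -valE.
    case: (ker_val d) d2 => b c /= ->; rewrite linear0 addr0 => b0.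
    by congr (_, _); apply: betai; rewrite b0 linear0.
  have [f fE] : exists f : {linear C -> ker_mod kappa}, f =1 fun c => pi (0, c).
    apply: linear_of => a x y; rewrite -linearP; congr (pi (_, _)).
    by rewrite /= scaler0 addr0.
  exists f; apply: linear_inj => c; rewrite fE => /(congr1 (@ker_val _ _ _ _)).
  rewrite piE; set a := theta' _ => -[] /eqP; rewrite sub0r oppr_eq0 => /eqP a0.
  have {}a0 : a = 0 by apply: alphai; rewrite a0 linear0.
  by rewrite a0 linear0 subr0.
(* Dually, the first coordinate is onto because [delta] is, and [b -> pi (b, 0)] is onto because
   [gamma] is. *)
have eDB : same_epigeny (ker_mod kappa) B.
  split.
    have [f fE] : exists f : {linear ker_mod kappa -> B}, f =1 fun d => (ker_val d).1.
      by apply: linear_of.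
    exists f => b; have [c cE] := deltas (- beta b).
    have kbc : (b, c) \in ker_pred kappa.
      by rewrite unfold_in kappaE /= cE subrr.
    by exists (KerMod kbc); rewrite fE.
  have [f fE] : exists f : {linear B -> ker_mod kappa}, f =1 fun b => pi (b, 0).
    apply: linear_of => a x y; rewrite -linearP; congr (pi (_, _)).
    by rewrite /= scaler0 addr0.
  exists f => d; have [a aE] := gammas (- (ker_val d).2).
  exists ((ker_val d).1 + alpha a); rewrite fE.
  (* Adding an element that [pi] kills clears the second coordinate of [d]. *)
  have wE : ((ker_val d).1 + alpha a, 0) = ker_val d + (alpha a, gamma a).
    by rewrite aE; case: (ker_val d) => b c; congr (_, _); rewrite /= subrr.
  apply: val_inj; rewrite -!valE piE wE linearD ker_valE add0r kappa_theta.
  by rewrite thetaK addrK.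
(* The kernel is nonzero as it maps onto [B], uniform as it embeds in [C], and couniform as an image
   of [B]. *)
have nD : nonzero_mod (ker_mod kappa).
  by case: eDB => eDB _; apply: epi_to_nonzero eDB _; case: uB => -[].
exists (ker_mod kappa); split=> //.
  split; first by case: mDC => m _; apply: mono_to_uniform m _ => //; case: uC.
  by case: eDB => _ e; apply: epi_to_couniform e _ => //; case: uB.
have [f fE] : exists f : {linear (A * ker_mod kappa)%type -> (B * C)%type},
    f =1 fun w => (alpha w.1, gamma w.1) + ker_val w.2.
  apply: linear_of => a x y /=; rewrite scalerDr addrACA; congr (_ + _).
  by rewrite !linearP.
exists f; apply: inj_surj_bij.
  apply: linear_inj => -[a d]; rewrite fE /= => ad0.
  have a0 : a = 0.
    have /(congr1 kappa) := ad0.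
    rewrite linearD ker_valE addr0 kappa_theta linear0 => a0.
    by rewrite -[a]thetaK a0 linear0.
  congr (_, _) => //; apply: val_inj.
  by move: ad0; rewrite a0 !linear0 [(0, 0) + _]add0r.
by move=> w; exists (theta' (kappa w), pi w); rewrite fE piE /= addrC subrK.
Qed.

(** The classes of [D] determine it up to isomorphism, so it can replace the module found by
    [exchange_exists]. *)
Lemma exchange_iso A B C D :
    biuniform A -> biuniform B -> biuniform C -> biuniform D ->
    same_monogeny A B -> same_epigeny A C -> same_monogeny D C -> same_epigeny D B ->
  lin_iso (A * D)%type (B * C)%type.
Proof.
move=> uA uB uC uD mAB eAC mDC eDB.
have [D' [uD' mD'C eD'B isoD']] := exchange_exists uA uB uC mAB eAC.
apply: lin_iso_trans isoD'; apply: lin_iso_prod; first exact: lin_iso_refl.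
apply: biuniform_lin_iso => //.
  exact: same_monogeny_trans mDC (same_monogeny_sym mD'C).
exact: same_epigeny_trans eDB (same_epigeny_sym eD'B).
Qed.

End Biuniform.

(** * Isomorphisms of direct products *)

Section Products.
Variables (R : pzRingType).

Lemma prod_iso_trans (I J K : Type) (U : I -> lmodType R) (V : J -> lmodType R)
    (W : K -> lmodType R) : prod_iso U V -> prod_iso V W -> prod_iso U W.
Proof.
move=> [f [fD fZ fbij]] [g [gD gZ gbij]]; exists (g \o f); split=> [x y|a x|] /=.
- by rewrite fD gD.
- by rewrite fZ gZ.
- exact: bij_comp.
Qed.

Lemma prod_iso_reindex (I J : Type) (V : J -> lmodType R) (s : I -> J) :
  bijective s -> prod_iso (fun i => V (s i)) V.
Proof.
case=> s' sK s'K.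
(* The coordinate at [s' j] lies in [V (s (s' j))] and is transported to [V j]; at [j = s i] the
   transport is trivial by uniqueness of identity proofs. *)
pose f (x : forall i, V (s i)) j := eq_rect (s (s' j)) V (x (s' j)) j (s'K j).
have fE x i : f x (s i) = x i.
  rewrite /f; move: (s'K (s i)); rewrite (sK i) => e.
  by rewrite (UIP_refl _ _ e).
exists f; split=> [x y|a x|].
- by apply: functional_extensionality_dep => j; rewrite -(s'K j) !fE.
- by apply: functional_extensionality_dep => j; rewrite -(s'K j) !fE.
exists (fun y i => y (s i)) => x; apply: functional_extensionality_dep => j.
  by rewrite fE.
by rewrite -(s'K j) fE.
Qed.

Lemma prod_iso_pointwise (I : Type) (A B : I -> lmodType R) :
  (forall i, lin_iso (A i) (B i)) -> prod_iso A B.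
Proof.
move=> AB.
pose f i := proj1_sig (constructive_indefinite_description _ (AB i)).
have fbij i : exists g, cancel (f i) g /\ cancel g (f i).
  by rewrite /f; case: constructive_indefinite_description => ? /= [g]; exists g.
pose g i := proj1_sig (constructive_indefinite_description _ (fbij i)).
have gP i : cancel (f i) (g i) /\ cancel (g i) (f i).
  by rewrite /g; case: constructive_indefinite_description.
exists (fun x i => f i (x i)); split=> [x y|a x|].
- by apply: functional_extensionality_dep => i; rewrite linearD.
- by apply: functional_extensionality_dep => i; rewrite linearZ.
exists (fun y i => g i (y i)) => x; apply: functional_extensionality_dep => i.
  exact: (gP i).1.
exact: (gP i).2.
Qed.

Lemma prod_glue (I : Type) (A : I -> lmodType R) (a b : I) : a <> b ->
  exists h : A a * A b -> forall i, A i, forall w, h w a = w.1 /\ h w b = w.2.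
Proof.
move=> ab.
(* Comparing dependent pairs avoids transport between [A i] and [A a] or [A b]. Coordinates other
   than [a] and [b] are arbitrary. *)
pose Q (w : A a * A b) i (v : A i) :=
  existT (fun i => A i : Type) i v = existT _ a w.1 \/
  existT (fun i => A i : Type) i v = existT _ b w.2.
have hP w i : (exists v, Q w i v) -> Q w i (epsilon (inhabits 0) (Q w i)).
  exact: epsilon_spec.
exists (fun w i => epsilon (inhabits 0) (Q w i)) => w; split.
  have [|e|e] := hP w a; [by exists w.1; left | exact: inj_pair2 e |].
  by case: ab; apply: (f_equal (@projT1 _ _) e).
have [|e|e] := hP w b; [by exists w.2; right | | exact: inj_pair2 e].
by case: ab; apply/esym/(f_equal (@projT1 _ _) e).
Qed.

Lemma prod_iso_two (I : Type) (A B : I -> lmodType R) (a b : I) :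
    a <> b -> (forall i, i = a \/ i = b) ->
  lin_iso (A a * A b)%type (B a * B b)%type -> prod_iso A B.
Proof.
move=> ab abI [f [g fK gK]].
have [hA hAE] := prod_glue A ab; have [hB hBE] := prod_glue B ab.
have ext (C : I -> lmodType R) (x y : forall i, C i) : x a = y a -> x b = y b -> x = y.
  by move=> xya xyb; apply: functional_extensionality_dep => i; case: (abI i) => ->.
have hBP w : hB w a = w.1 /\ hB w b = w.2 by apply: hBE.
exists (fun x => hB (f (x a, x b))); split=> [x y|c x|].
- have -> : (x a + y a, x b + y b) = (x a, x b) + (y a, y b) by [].
  by rewrite linearD; apply: ext; rewrite ?(hBP _).1 ?(hBP _).2.
- have -> : (c *: x a, c *: x b) = c *: (x a, x b) by [].
  by rewrite linearZ; apply: ext; rewrite ?(hBP _).1 ?(hBP _).2.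
exists (fun y => hA (g (y a, y b))) => x.
  by rewrite (hBE _).1 (hBE _).2 -surjective_pairing fK; apply: ext; rewrite ?(hAE _).1 ?(hAE _).2.
by rewrite (hAE _).1 (hAE _).2 -surjective_pairing gK; apply: ext; rewrite ?(hBE _).1 ?(hBE _).2.
Qed.

(** A product over [I] is a product of products over the fibers of [p], and the chosen isomorphisms
    act fiber by fiber. *)
Lemma prod_iso_fibers (I K : Type) (p : I -> K) (A B : I -> lmodType R) :
    (forall k, prod_iso (fun i : {i | p i = k} => A (sval i))
                        (fun i : {i | p i = k} => B (sval i))) ->
  prod_iso A B.
Proof.
move=> AB.
pose f k := proj1_sig (constructive_indefinite_description _ (AB k)).
have fP k : [/\ forall x y, f k (fun i => x i + y i) = (fun i => f k x i + f k y i),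
                forall (a : R) x, f k (fun i => a *: x i) = (fun i => a *: f k x i)
              & bijective (f k)].
  by rewrite /f; case: constructive_indefinite_description.
have gP' k : exists g, cancel (f k) g /\ cancel g (f k).
  by have [_ _ [g]] := fP k; exists g.
pose g k := proj1_sig (constructive_indefinite_description _ (gP' k)).
have gP k : cancel (f k) (g k) /\ cancel (g k) (f k).
  by rewrite /g; case: constructive_indefinite_description.
pose F (x : forall i, A i) i := f (p i) (fun j => x (sval j)) (exist _ i erefl).
pose G (y : forall i, B i) i := g (p i) (fun j => y (sval j)) (exist _ i erefl).
have FE x k : (fun j : {i | p i = k} => F x (sval j)) = f k (fun j => x (sval j)).
  by apply: functional_extensionality_dep => -[j e]; case: k / e.
have GE y k : (fun j : {i | p i = k} => G y (sval j)) = g k (fun j => y (sval j)).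
  by apply: functional_extensionality_dep => -[j e]; case: k / e.
exists F; split=> [x y|a x|].
- apply: functional_extensionality_dep => i; rewrite /F.
  by have [-> _ _] := fP (p i).
- apply: functional_extensionality_dep => i; rewrite /F.
  by have [_ -> _] := fP (p i).
exists G => x; apply: functional_extensionality_dep => i.
  by rewrite /G FE (gP _).1.
by rewrite /F GE (gP _).2.
Qed.

End Products.

(** * Simultaneous exchanges along an involution *)

Section Swap.
Variables (R : pzRingType).

(** The product splits over the orbits of [t]: a fixed point gives an isomorphism of modules with
    equal classes, a pair [i], [t i] gives an exchange. *)
Lemma prod_iso_involution (I : Type) (t : I -> I) (A B : I -> lmodType R) :
    involutive t ->
    (forall i, biuniform (A i)) -> (forall i, biuniform (B i)) ->
    (forall i, same_monogeny (A i) (B i)) ->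
    (forall i, same_epigeny (A i) (B (t i))) ->
  prod_iso A B.
Proof.
(* Orbits are encoded as predicates, so [p] sends [i] to its orbit; predicates that are not orbits
   have empty fibers. *)
move=> tK uA uB mAB eAB; pose p i j := j = i \/ j = t i.
apply: (prod_iso_fibers (p := p)) => k.
have [[i pi]|empty] := classic (exists i, p i = k); last first.
  by apply: prod_iso_pointwise => -[i pi]; case: empty; exists i.
have inF (x : {j | p j = k}) : sval x = i \/ sval x = t i.
  case: x => j /= pj; have : p j j by left.
  by rewrite pj -pi.
have pti : p (t i) = k.
  rewrite -pi; apply: functional_extensionality => j.
  by apply: propositional_extensionality; rewrite /p tK; split=> -[]; auto.
have val_eq (x y : {j | p j = k}) : sval x = sval y -> x = y.
  by case: x y => x px [y py] /= xy; subst y; rewrite (proof_irrelevance _ px py).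
have [ti|ti] := classic (t i = i).
  apply: prod_iso_pointwise => x; apply: biuniform_lin_iso => //.
  have -> : sval x = i by case: (inF x) => // ->.
  by rewrite -{2}ti.
apply: (@prod_iso_two _ _ _ _ (exist _ i pi) (exist _ (t i) pti)) => /=.
- by move=> /(f_equal (@sval _ _)) /= /esym.
- by move=> x; case: (inF x) => xE; [left | right]; apply: val_eq.
- by apply: exchange_iso => //; rewrite -{2}[i]tK.
Qed.

End Swap.

(** * Orbits of a bijection and their reflections *)

Section Orbits.
Variables (I : Type) (rho : I -> I).

(** For bijective [rho] this reads [i = rho^(m - n) b]; two natural iterates stand for an integer
    power. *)
Definition same_orbit (i b : I) := exists n m : nat, iter n rho i = iter m rho b.

(** In integer powers, [i = rho^k b] and [j = rho^-k b] with [k = m - n]. *)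
Definition mirror (b i j : I) :=
  exists n m : nat, iter n rho i = iter m rho b /\ iter m rho j = iter n rho b.

Hypothesis rho_bij : bijective rho.

Lemma iter_inj n : injective (iter n rho).
Proof. by elim: n => // n IHn x y /= /(bij_inj rho_bij) /IHn. Qed.

Lemma iter_surj n y : exists x, iter n rho x = y.
Proof.
have [rho' _ rho'K] := rho_bij.
elim: n y => [|n IHn] y; first by exists y.
by have [x xE] := IHn (rho' y); exists x; rewrite iterS xE.
Qed.

Lemma same_orbit_refl i : same_orbit i i.
Proof. by exists 0, 0. Qed.

Lemma same_orbit_sym i j : same_orbit i j -> same_orbit j i.
Proof. by case=> n [m ij]; exists m, n. Qed.

Lemma same_orbit_trans i j k : same_orbit i j -> same_orbit j k -> same_orbit i k.
Proof.
case=> n [m ij] [n' [m' jk]]; exists (n' + n)%N, (m + m')%N.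
by rewrite iterD ij -iterD addnC iterD jk -iterD.
Qed.

Lemma same_orbit_rho i : same_orbit (rho i) i.
Proof. by exists 0, 1%N. Qed.

Lemma mirror_sym b i j : mirror b i j -> mirror b j i.
Proof. by case=> n [m [? ?]]; exists m, n. Qed.

Lemma mirror_same_orbit b i j : mirror b i j -> same_orbit i j.
Proof.
case=> n [m [ib jb]]; apply: (@same_orbit_trans _ b); first by exists n, m.
by exists n, m.
Qed.

(** In a finite orbit [i] does not determine [n] and [m]. Computing [rho^(n' + n) i] in two ways
    shows that both choices give the same point. *)
Lemma mirror_uniq b i j j' : mirror b i j -> mirror b i j' -> j = j'.
Proof.
case=> n [m [ib jb]] [n' [m' [ib' jb']]]; apply: (@iter_inj (m' + m)).
rewrite iterD jb addnC iterD jb' -!iterD.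
have : iter (n' + n) rho i = iter (n + n') rho i by rewrite addnC.
rewrite !iterD ib ib' -!iterD => e.
by rewrite addnC -e addnC.
Qed.

Lemma mirror_exists b i : same_orbit i b -> exists j, mirror b i j.
Proof. by case=> n [m ib]; have [j jb] := iter_surj m (iter n rho b); exists j, n, m. Qed.

(** If [rho i = rho^k b], then [i = rho^(k - 1) b], whose reflection is [rho^(1 - k) b = rho j]. *)
Lemma mirror_rho b i j : mirror b (rho i) j -> mirror b i (rho j).
Proof.
case=> n [m [ib jb]]; exists n.+1, m; rewrite iterSr; split=> //.
by rewrite -iterSr iterS jb.
Qed.

(* Reflecting every orbit at a base point, i.e. exchanging [rho^n b] and
   [rho^-n b], writes [rho] as the product of the involutions [s] and [s \o rho]. *)
Lemma exists_mirror : exists s : I -> I,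
  [/\ involutive s, forall i, rho (s (rho i)) = s i & forall i, same_orbit i (s i)].
Proof.
pose base i := epsilon (inhabits i) (same_orbit i).
have baseP i : same_orbit i (base i).
  by apply: epsilon_spec; exists i; apply: same_orbit_refl.
(* Points of one orbit have equal orbit predicates, and the choice ignores the inhabitation witness,
   so they share a base point. *)
have base_eq i j : same_orbit i j -> base i = base j.
  move=> ij; rewrite /base.
  have -> : same_orbit i = same_orbit j.
    apply: functional_extensionality => k; apply: propositional_extensionality.
    split=> [ik|jk]; last exact: same_orbit_trans ij jk.
    exact: same_orbit_trans (same_orbit_sym ij) ik.
  exact: epsilon_inh_irrelevance (ex_intro _ j (same_orbit_refl j)).
pose s i := epsilon (inhabits i) (mirror (base i) i).
have sP i : mirror (base i) i (s i).
  by apply: epsilon_spec; apply: mirror_exists.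
have orb i := mirror_same_orbit (sP i).
exists s; split=> // i.
  apply: (@mirror_uniq (base i) (s i)); last exact/mirror_sym/sP.
  by rewrite (base_eq _ _ (orb i)); apply: sP.
apply: (@mirror_uniq (base i) i); last exact: sP.
by apply: mirror_rho; rewrite -(base_eq _ _ (same_orbit_rho i)); apply: sP.
Qed.

End Orbits.

(** * Pairs of classes realised by a biuniform module *)

Section Classes.
Variables (R : pzRingType) (I : Type) (W : I -> lmodType R) (rho : I -> I).

(** Existence of the module [T(a, b)]. *)
Definition class_inhabited (a b : I) := exists D : lmodType R,
  [/\ biuniform D, same_monogeny D (W a) & same_epigeny D (W b)].

(** The fourth corner of a rectangle, by [exchange_exists]. Symmetry and transitivity below are the
    cases with diagonal corners [W i]. *)
Lemma class_inhabited_exchange a b c d :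
    class_inhabited a b -> class_inhabited a d -> class_inhabited c b ->
  class_inhabited c d.
Proof.
move=> [A [uA mA eA]] [B [uB mB eB]] [C [uC mC eC]].
have [|D [uD mD eD _]] := @exchange_exists _ A B C uA uB uC
    (same_monogeny_trans mA (same_monogeny_sym mB)).
  exact: same_epigeny_trans eA (same_epigeny_sym eC).
exists D; split=> //; first exact: same_monogeny_trans mD mC.
exact: same_epigeny_trans eD eB.
Qed.

Hypothesis uW : forall i, biuniform (W i).
Hypothesis rhoW : forall i, class_inhabited i (rho i).

Lemma class_inhabited_refl a : class_inhabited a a.
Proof.
by exists (W a); split; [|exact: same_monogeny_refl|exact: same_epigeny_refl].
Qed.

Lemma class_inhabited_sym a b : class_inhabited a b -> class_inhabited b a.
Proof.
by move=> ab; apply: class_inhabited_exchange ab _ _; apply: class_inhabited_refl.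
Qed.

Lemma class_inhabited_trans a b c :
  class_inhabited a b -> class_inhabited b c -> class_inhabited a c.
Proof.
by move=> ab bc; apply: class_inhabited_exchange bc ab; apply: class_inhabited_refl.
Qed.

Lemma same_orbit_class_inhabited a b : same_orbit rho a b -> class_inhabited a b.
Proof.
have it n i : class_inhabited i (iter n rho i).
  elim: n => [|n IHn]; first exact: class_inhabited_refl.
  exact: class_inhabited_trans IHn (rhoW _).
case=> n [m ab]; apply: class_inhabited_trans (it n a) _; rewrite ab.
exact/class_inhabited_sym/it.
Qed.

End Classes.

Theorem theorem3p1 (R : pzRingType) (I J : Type)
  (U : I -> lmodType R^c) (V : J -> lmodType R^c)
  (HU : forall i, biuniform (U i)) (HV : forall j, biuniform (V j))
  (sigma tau : I -> J) (Hsigma : bijective sigma) (Htau : bijective tau)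
  (Hm : forall i, same_monogeny (U i) (V (sigma i)))
  (He : forall i, same_epigeny (U i) (V (tau i))) :
  prod_iso U V.
Proof.
case: (Hsigma) => sigma' sigmaK sigma'K.
pose W i := V (sigma i); pose rho i := sigma' (tau i).
have rho_bij : bijective rho by apply: bij_comp => //; exists sigma.
have eU i : same_epigeny (U i) (W (rho i)) by rewrite /W /rho sigma'K.
have uW i : biuniform (W i) by apply: HV.
have [s [sK rho_s s_orb]] := exists_mirror rho_bij.
(* [U j] serves as [T(j, rho j)], so [T(i, s i)] exists within each orbit. *)
have exD i : class_inhabited W i (s i).
  apply: (same_orbit_class_inhabited uW) (s_orb i) => j.
  by exists (U j).
pose D i := proj1_sig (constructive_indefinite_description _ (exD i)).
have DP i : [/\ biuniform (D i), same_monogeny (D i) (W i) & same_epigeny (D i) (W (s i))].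
  by rewrite /D; case: constructive_indefinite_description.
have uD i : biuniform (D i) by have [] := DP i.
have mD i : same_monogeny (D i) (W i) by have [] := DP i.
have eD i : same_epigeny (D i) (W (s i)) by have [] := DP i.
apply: prod_iso_trans (prod_iso_reindex V Hsigma).
apply: (@prod_iso_trans _ _ _ _ _ D).
  (* First round: [D (s (rho i))] has the epigeny class of [W (s (s (rho i))) = W (rho i)], which is
     that of [U i]. *)
  apply: (@prod_iso_involution _ _ (fun i => s (rho i))) => // i.
  - by rewrite /= rho_s sK.
  - exact: same_monogeny_trans (Hm i) (same_monogeny_sym (mD i)).
  - apply: same_epigeny_trans (eU i) (same_epigeny_sym _).
    by rewrite -{2}[rho i]sK.
(* Second round: exchanges along [s] turn [D] into [W]. *)
exact: (@prod_iso_involution _ _ s).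
Qed.
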